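(* Let $f:(0,\sqrt2]\to\mathbb{R}$ be a non-increasing convex function, defined at zero by the (possibly infinite) value $f(0)=\lim_{t\to0^+}f(t)$, and let $K(x,y)=f\left(\sqrt{2-2|\langle x,y\rangle|^2}\right)$ for $x,y\in\mathbb{S}^1\subset\mathbb{R}^2$. Then for every $N$ the configuration $$X_N^{(h)}=\{e^{i\cdot 0},e^{i\frac{\pi}{N}},e^{i\frac{2\pi}{N}},\dots,e^{i\frac{(N-1)\pi}{N}}\}\subset\mathbb{S}^1\subset\mathbb{R}^2$$ of equally spaced points on the half-circle minimizes $$E_K(X)=\sum_{i\ne j}K(x_i,x_j)$$ over all $N$-point configurations $X=\{x_1,\dots,x_N\}\subset\mathbb{S}^1$. If, in addition, $f$ is strictly convex, then every $N$-point configuration minimizing $E_K$ is projectively equivalent to $X_N^{(h)}$.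
   Context: $\mathbb{S}^1$ is the unit circle in $\mathbb{R}^2$, with $\mathbb{R}^2$ identified with $\mathbb{C}$ to write $e^{i\theta}=(\cos\theta,\sin\theta)$; $\langle\cdot,\cdot\rangle$ is the real Euclidean inner product on $\mathbb{R}^2$. Configurations may have repeated points. Two $N$-point configurations in $\mathbb{S}^1$ are projectively equivalent if one is obtained from the other by a combination of: (i) applying a fixed orthogonal operator $U$ of $\mathbb{R}^2$ to all points; (ii) changing the sign of any of the points $x_i$; (iii) permuting the points $x_1,\dots,x_N$. *)

(* Defs.v *)
From HB Require Import structures.
From mathcomp Require Import all_boot all_order all_fingroup all_algebra.
From mathcomp Require Import all_classical all_reals all_analysis.

Set Implicit Arguments.
Unset Strict Implicit.
Unset Printing Implicit Defensive.

Import Order.TTheory GRing.Theory Num.Theory.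
Import numFieldNormedType.Exports.

Local Open Scope classical_set_scope.
Local Open Scope ring_scope.
Local Open Scope convex_scope.

(* Strict counterpart of the library's [convex_function]. *)
Definition strictly_convex_function (R : numFieldType) (E : lmodType R)
    (E' := convex_lmodType E) (D : set E') (f : E' -> R^o) :=
  forall t : {i01 R}, 0 < t%:num -> t%:num < 1 ->
    {in D &, forall x y : E', x != y ->
      (f (x <| t |> y) < f x <| t |> f y)%R}.

Definition dot (R : pzRingType) (n : nat) (x y : 'cV[R]_n) : R :=
  \sum_i x i 0 * y i 0.

Definition orthogonal_mx (R : pzRingType) (n : nat) (U : 'M[R]_n) : Prop :=
  U^T *m U = 1%:M.

Section Circle.
Variable R : realType.

Definition unit_circle : set 'cV[R]_2 := [set x | dot x x = 1].

Definition expi (theta : R) : 'cV[R]_2 :=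
  \col_i (if i == 0 then cos theta else sin theta).

(* The extension of f to 0 by its right limit, possibly +oo.  The limit exists
   in \bar R as soon as f is monotone to the right of 0. *)
Definition extend0 (f : R -> R) (t : R) : \bar R :=
  if t == 0 then lim ((f s)%:E @[s --> 0^'+]) else (f t)%:E.

Definition proj_kernel (f : R -> R) (x y : 'cV[R]_2) : \bar R :=
  extend0 f (Num.sqrt (2 - 2 * `|dot x y| ^+ 2)).

(* An N-point configuration is a family indexed by 'I_N, so that points may be
   repeated. *)
Definition in_circle (N : nat) (X : 'I_N -> 'cV[R]_2) : Prop :=
  forall i, unit_circle (X i).

Definition energy (K : 'cV[R]_2 -> 'cV[R]_2 -> \bar R) (N : nat)
    (X : 'I_N -> 'cV[R]_2) : \bar R :=
  (\sum_(i < N) \sum_(j < N | i != j) K (X i) (X j))%E.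

Definition energy_minimizer (K : 'cV[R]_2 -> 'cV[R]_2 -> \bar R) (N : nat)
    (X : 'I_N -> 'cV[R]_2) : Prop :=
  in_circle X /\
  forall Y : 'I_N -> 'cV[R]_2, in_circle Y -> (energy K X <= energy K Y)%E.

(* Orthogonal operators commute with sign changes and permutations, and sign
   changes can be moved past permutations, so every combination of the three
   operations has the form below. *)
Definition projectively_equivalent (N : nat) (X Y : 'I_N -> 'cV[R]_2) : Prop :=
  exists (U : 'M[R]_2) (e : 'I_N -> bool) (s : 'S_N),
    orthogonal_mx U /\ forall i, Y i = (-1) ^+ e i *: (U *m X (s i)).

Definition half_circle_config (N : nat) : 'I_N -> 'cV[R]_2 :=
  fun i => expi (i%:R * pi / N%:R).

End Circle.

Arguments half_circle_config R N : clear implicits.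

(* Main.v *)
Require Import Defs.
From HB Require Import structures.
From mathcomp Require Import all_boot all_order all_fingroup all_algebra.
From mathcomp Require Import all_classical all_reals all_analysis.
From mathcomp Require Import ring lra zify.

Import Order.TTheory GRing.Theory Num.Theory.
Import numFieldNormedType.Exports.

Set Implicit Arguments.
Unset Strict Implicit.

Local Open Scope classical_set_scope.
Local Open Scope ring_scope.

(** A sign change lets every point of the configuration be written as
    [expi (theta i)] with [theta i] in [[0, pi]], and a permutation makes
    [theta] nondecreasing.  For unit vectors at angles [a] and [b] the kernel
    is [f (sqrt 2 * `|sin (b - a)|)].  Hence for an ordered pair [(i, j)] it is
    [h (turn theta i j)], where [h x = f (sqrt 2 * sin x)] on [[0, pi]] and the
    turn is [theta j - theta i], increased by [pi] when [j] comes before [i],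
    so that it always lies in [[0, pi]].  For the equally spaced angles
    [grid i = i * pi / N], the turn from [i] to [j] depends only on the cyclic
    difference [k = j - i] modulo [N]: it is [grid k].

    The function [h] is convex, since [sin] is concave on [[0, pi]] and [f] is
    convex and nonincreasing; so at each interior point [grid k] it has a
    supporting line, of slope [m k] say ([angular_support]).  Bounding every
    term of the energy by that line gives
      [energy X >= energy (half circle)
                    + \sum_(i != j) m (j - i) * (turn theta i j - grid (j - i))],
    and the wrap-around terms [pi] cancel in the last factor, which equals
    [d j - d i] for [d i = theta i - grid i].  The correction therefore
    vanishes, because [d j] gets the total coefficient
    [\sum_(k != 0) m k - \sum_(k != 0) m k] ([cyclic_sum_diff0]).  Working with
    supporting lines rather than with Jensen's inequality for [h] keeps the
    right-hand side real even when [f] is unbounded near 0.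

    If [f] is strictly convex it is strictly decreasing, and then the
    supporting lines touch [h] only at [grid k].  For a minimizer all the
    inequalities are equalities, so [d] is constant, [theta] is a translate
    of [grid], and a rotation finishes the proof. *)

(** * Convex nonincreasing functions on a right-closed interval *)

Section ConvexReal.
Variables (R : realType) (f : R -> R) (b : R).
Hypothesis f_convex : @convex_function R R^o `]0, b]%classic f.
Hypothesis f_nonincreasing : {in `]0, b] &, nonincreasing_fun f}.

Lemma convex_combination_le t x y : 0 <= t <= 1 -> 0 < x <= b -> 0 < y <= b ->
  f (t * x + (1 - t) * y) <= t * f x + (1 - t) * f y.
Proof.
move=> t01 xb yb.
have ti : Itv.spec (@Itv.num_sem R) (Itv.Real `[0%Z, 1%Z]) t.
  by rewrite /= /Itv.num_sem /= num_real /= in_itv.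
apply: (@f_convex (Itv.mk ti) x y); rewrite inE /= in_itv /=;
  [exact: xb | exact: yb].
Qed.

(** The three-chord inequality, from the convex combination of [x] and [y] that
    equals [s]; cleared of denominators so that it can be divided either way. *)
Lemma convex_slopes x s y : 0 < x -> x < s -> s < y -> y <= b ->
  (f s - f x) * (y - s) <= (f y - f s) * (s - x).
Proof.
move=> x0 xs sy yb.
have yx : 0 < y - x by lra.
have := @convex_combination_le ((y - s) / (y - x)) x y.
have -> : (y - s) / (y - x) * x + (1 - (y - s) / (y - x)) * y = s by field; lra.
have -> : (y - s) / (y - x) * f x + (1 - (y - s) / (y - x)) * f y =
  ((y - s) * f x + (s - x) * f y) / (y - x) by field; lra.
rewrite divr_ge0 ?ler_pdivrMr ?mul1r//; try lra.
by rewrite ler_pdivlMr//; lra.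
Qed.

(** The slope [- p] is the supremum of the slopes of the chords ending at [s]
    from the left; the slope of any chord starting at [s] bounds that set from above. *)
Lemma convex_interior_support s : 0 < s < b ->
  exists p, forall t, 0 < t <= b -> f s - p * (t - s) <= f t.
Proof.
move=> /andP[s0 sb].
pose S := [set (f s - f x) / (s - x) | x in `]0, s[ ]%classic.
have S0 : S !=set0.
  by exists ((f s - f (s / 2)) / (s - s / 2)); exists (s / 2) => //=; rewrite in_itv /=; lra.
have Sub y : s < y -> y <= b -> ubound S ((f y - f s) / (y - s)).
  move=> sy yb _ [x + <-]; rewrite /= in_itv /= => /andP[x0 xs].
  rewrite ler_pdivrMr ?subr_gt0// mulrAC ler_pdivlMr ?subr_gt0//.
  exact: convex_slopes.
have Sb : has_ubound S by exists ((f b - f s) / (b - s)); exact: Sub.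
exists (- sup S) => t /andP[t0 tb]; case: (ltgtP t s) => [ts|st|->]; last lra.
  have : (f s - f t) / (s - t) <= sup S.
    by apply: ub_le_sup => //; exists t => //=; rewrite in_itv /= t0.
  by rewrite ler_pdivrMr ?subr_gt0//; lra.
have : sup S <= (f t - f s) / (t - s) by apply: ge_sup => //; exact: Sub.
by rewrite ler_pdivlMr ?subr_gt0//; lra.
Qed.

(** At the right endpoint a convex function may fail to have a supporting line
    of finite slope; monotonicity supplies the horizontal one. *)
Lemma convex_nonincreasing_support s : 0 < s <= b ->
  exists2 p, 0 <= p & forall t, 0 < t <= b -> f s - p * (t - s) <= f t.
Proof.
move=> /andP[s0]; rewrite le_eqVlt => /predU1P[->|sb].
  exists 0 => // t /andP[t0 tb]; rewrite mul0r subr0.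
  by apply: f_nonincreasing; rewrite ?in_itv /= ?t0 ?lexx ?(lt_le_trans t0 tb).
have [p fp] : exists p, forall t, 0 < t <= b -> f s - p * (t - s) <= f t.
  by apply: convex_interior_support; rewrite s0.
exists p => //.
have b0 := lt_trans s0 sb.
have : f b <= f s by apply: f_nonincreasing; rewrite ?in_itv /= ?s0 ?b0 ?lexx ?ltW.
have := fp b; rewrite b0 lexx => /(_ isT); nra.
Qed.

(** If [f] took the same value at [x] and [y], strict convexity would put its
    value at the midpoint below [f y]. *)
Lemma strictly_convex_nonincreasing_decreasing :
  @strictly_convex_function R R^o `]0, b]%classic f ->
  forall x y, 0 < x -> x < y -> y <= b -> f y < f x.
Proof.
move=> fsc x y x0 xy yb.
have ti : Itv.spec (@Itv.num_sem R) (Itv.Real `[0%Z, 1%Z]) (2^-1 : R).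
  by rewrite /= /Itv.num_sem /= num_real /= in_itv /=; lra.
have : f (2^-1 * x + (1 - 2^-1) * y) < 2^-1 * f x + (1 - 2^-1) * f y.
  by apply: (fsc (Itv.mk ti) _ _ x y); rewrite ?inE /= ?in_itv ?lt_eqF//=; lra.
have : f y <= f (2^-1 * x + (1 - 2^-1) * y).
  by apply: f_nonincreasing; rewrite ?in_itv /=; lra.
lra.
Qed.

(** By monotonicity the limit at 0 is the supremum of the values. *)
Lemma le_extend0_0 t : 0 < t <= b -> ((f t)%:E <= extend0 f 0)%E.
Proof.
move=> /andP[t0 tb]; rewrite /extend0 eqxx.
have cv : (f s)%:E @[s --> 0^'+] -->
    ereal_sup [set (f x)%:E | x in [set` `]0, b]]].
  apply: (nonincreasing_at_right_cvge (f := fun s => (f s)%:E)) => /=.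
    by rewrite bnd_simp; exact: lt_le_trans tb.
  by move=> x y xb yb xy; rewrite lee_fin f_nonincreasing.
rewrite (cvg_lim _ cv)//; apply: ereal_sup_ubound.
by exists t => //=; rewrite in_itv /= t0.
Qed.

End ConvexReal.

(** * Supporting lines in the angle *)

(** By the mean value theorem the chord slope between [c] and [x] is a value
    of [cos] strictly in between, and [cos] decreases on [[0, pi]]. *)
Lemma sin_lt_tangent (R : realType) (c x : R) :
  0 <= c <= pi -> 0 <= x <= pi -> x != c ->
  sin x < sin c + cos c * (x - c).
Proof.
move=> /andP[c0 cpi] /andP[x0 xpi].
have MV (u v : R) : u < v ->
    exists2 z, z \in `]u, v[ & sin v - sin u = cos z * (v - u).
  move=> uv; apply: MVT => //.
  exact/continuous_subspaceT/continuous_sin.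
rewrite neq_lt => /orP[] h; have [z] := MV _ _ h; rewrite in_itv /= => /andP[z1 z2] e.
  have : cos c < cos z by rewrite ltr_cos ?in_itv /= ?z2//; lra.
  nra.
have : cos z < cos c by rewrite ltr_cos ?in_itv /= ?z1//; lra.
nra.
Qed.

Section AngularSupport.
Variables (R : realType) (f : R -> R).
Hypothesis f_convex : @convex_function R R^o `]0, Num.sqrt 2]%classic f.
Hypothesis f_nonincreasing : {in `]0, Num.sqrt 2] &, nonincreasing_fun f}.

Let r2 : R := Num.sqrt 2.

(** If [- p] is the slope of a supporting line of [f] at [s = sqrt 2 * sin c],
    then, as [p >= 0], the tangent bound on [sin] shows that
    [- (p * sqrt 2 * cos c)] is a supporting slope in the angle.  When [s] is
    less than [sqrt 2] a strictly decreasing [f] forces [p > 0], and the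
    strictness of the bound on [sin] carries over, including at [x = pi - c]
    where [sin x = sin c].  When [s = sqrt 2], that is [c = pi / 2], the line
    is horizontal and strictness is that of [f]. *)
Lemma angular_support c : 0 < c < pi -> exists m, forall x, 0 <= x <= pi ->
  ((f (r2 * sin c) + m * (x - c))%:E <= extend0 f (r2 * sin x))%E /\
  ((forall u v, 0 < u -> u < v -> v <= r2 -> f v < f u) -> x != c ->
   ((f (r2 * sin c) + m * (x - c))%:E < extend0 f (r2 * sin x))%E).
Proof.
move=> /[dup] cpi /andP[c0 cp].
have r0 : 0 < r2 by rewrite sqrtr_gt0.
have sc0 : 0 < sin c by apply: sin_gt0_pi.
set s := r2 * sin c.
have s0 : 0 < s by rewrite mulr_gt0.
have sr : s <= r2 by rewrite ler_piMr ?sin_le1// ltW.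
have sI : 0 < s <= r2 by rewrite s0.
have [p p0 fp] := convex_nonincreasing_support f_convex f_nonincreasing sI.
have fp0 t : 0 <= t <= r2 -> ((f s - p * (t - s))%:E <= extend0 f t)%E.
  move=> /andP[]; rewrite le_eqVlt => /predU1P[<- _ {t}|t0 tr]; last first.
    by rewrite /extend0 gt_eqF// lee_fin; apply: fp; rewrite t0.
  (* at 0 the bound is the limit of the bounds at small positive t *)
  have : forall e, 0 < e -> ((f s - p * (0 - s))%:E <= extend0 f 0 + e%:E)%E.
    move=> e e0; pose t := Num.min r2 (e / (p + 1)).
    have p1 : 0 < p + 1 by lra.
    have t0 : 0 < t by rewrite lt_min r0 divr_gt0.
    have tr : t <= r2 by rewrite ge_min lexx.
    have pt : p * t <= e.
      have : t <= e / (p + 1) by rewrite ge_min lexx orbT.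
      by rewrite ler_pdivlMr//; nra.
    have tI : 0 < t <= r2 by rewrite t0.
    have := le_extend0_0 f_nonincreasing tI; move: (fp t tI).
    case: (extend0 f 0) => [z| |]; rewrite ?leey// -?EFinD ?lee_fin//; lra.
  by move=> h; apply/lee_addgt0Pr.
exists (- (p * r2 * cos c)) => x xpi.
have xr : 0 <= r2 * sin x <= r2.
  by rewrite mulr_ge0 ?sin_ge0_pi ?(ltW r0)//= ler_piMr ?sin_le1// ltW.
have cpi' : 0 <= c <= pi by rewrite !ltW.
have le_fx := fp0 _ xr.
have [->|xc] := eqVneq x c; first by rewrite subrr mulr0 addr0 -/s; split=> //;
  rewrite /extend0 gt_eqF.
have tg := sin_lt_tangent cpi' xpi xc.
have le_m : f s + - (p * r2 * cos c) * (x - c) <= f s - p * (r2 * sin x - s).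
  by rewrite /s -subr_ge0; have := mulr_ge0 p0 (ltW r0); nra.
split; first by apply: le_trans le_fx; rewrite lee_fin.
move=> fdec _; have [sb|sb] := ltP s r2.
  have pp : 0 < p.
    rewrite lt_neqAle p0 andbT; apply/negP => /eqP p00.
    have := fp r2; rewrite r0 lexx => /(_ isT).
    by have := fdec _ _ s0 sb (lexx _); rewrite -p00; lra.
  apply: lt_le_trans le_fx; rewrite lte_fin /s -subr_gt0.
  by have := mulr_gt0 pp r0; nra.
have es : s = r2 by apply/eqP; rewrite eq_le sr.
have sc1 : sin c = 1.
  by apply: (mulfI (lt0r_neq0 r0)); rewrite mulr1.
have cc0 : cos c = 0.
  by apply/eqP; rewrite -sqrf_eq0 cos2sin2 sc1 expr1n subrr.
(* now the claim is f (sqrt 2) < f (sqrt 2 * sin x); if sin x = 0 any value of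
   f between the two points, here at sqrt 2 / 2, separates them *)
rewrite cc0 mulr0 oppr0 mul0r addr0.
have sx1 : r2 * sin x < r2 by rewrite gtr_pMr//; move: tg; rewrite cc0 sc1; lra.
move: xr => /andP[]; rewrite le_eqVlt => /predU1P[<- _|x0 _]; last first.
  by rewrite /extend0 gt_eqF// lte_fin es fdec.
have hI : 0 < r2 / 2 <= r2 by lra.
apply: lt_le_trans (le_extend0_0 f_nonincreasing hI).
by rewrite lte_fin es fdec//; lra.
Qed.

End AngularSupport.

(** * Sums over ordered pairs *)

(** The reals [a i] are finite, so a single strict inequality would survive in
    the sum, whatever infinite values [A] takes. *)
Lemma sum_lee_not_lt (R : realType) (I : finType) (P : pred I)
    (a : I -> R) (A : I -> \bar R) :
  (forall i, P i -> ((a i)%:E <= A i)%E) ->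
  (\sum_(i | P i) A i <= (\sum_(i | P i) a i)%:E)%E ->
  forall i, P i -> ~~ ((a i)%:E < A i)%E.
Proof.
move=> aA sA i Pi; apply/negP => lt_i; move: sA; apply/negP; rewrite -ltNge.
rewrite (bigD1 i)//= [ltRHS](bigD1 i)//= EFinD; apply: lte_leD => //.
by rewrite -sumEFin; apply: lee_sum => j /andP[Pj _]; exact: aA.
Qed.

Section CyclicSum.
Variables (R : comPzRingType) (n : nat).
Implicit Types m d : 'I_n.+1 -> R.

(** For fixed [j], as for fixed [i], the difference [j - i] runs over the whole
    cyclic group, so both halves of the sum factor as [(\sum m) * (\sum d)];
    the diagonal terms are zero and can be added. *)
Lemma cyclic_sum_diff0 m d :
  \sum_(p : 'I_n.+1 * 'I_n.+1 | p.1 != p.2)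
    m (p.2 - p.1) * (d p.2 - d p.1) = 0.
Proof.
have -> : \sum_(p : 'I_n.+1 * 'I_n.+1 | p.1 != p.2)
    m (p.2 - p.1) * (d p.2 - d p.1) =
  \sum_(p : 'I_n.+1 * 'I_n.+1) m (p.2 - p.1) * (d p.2 - d p.1).
  rewrite [RHS](bigID (fun p => p.1 != p.2))/= [X in _ = _ + X]big1 ?addr0//.
  by move=> p /negPn/eqP ->; rewrite (subrr (d _)) mulr0.
rewrite -(pair_bigA _ (fun i j => m (j - i) * (d j - d i)))/=.
under eq_bigr => i _ do (under eq_bigr => j _ do rewrite mulrBr; rewrite sumrB).
rewrite sumrB exchange_big /=; apply/eqP; rewrite subr_eq0; apply/eqP.
apply: eq_bigr => j _; rewrite -!mulr_suml; congr (_ * _).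
rewrite (reindex_inj (h := fun i => j - i))/=; last first.
  by move=> x y /addrI/oppr_inj.
rewrite [RHS](reindex_inj (h := fun i => i + j))/=; last exact: addIr.
by apply: eq_bigr => i _; rewrite subKr addrK.
Qed.

Lemma ord_subE (i j : 'I_n.+1) :
  ((j - i)%R + i = j + (j < i) * n.+1)%N.
Proof.
have -> : (j - i)%R = ((j + (n.+1 - i) %% n.+1) %% n.+1)%N :> nat by [].
have := ltn_ord i; have := ltn_ord j; case: (ltnP j i) => ji jn i_n.
  by rewrite modnDmr modn_small; lia.
rewrite modnDmr (_ : j + (n.+1 - i) = n.+1 + (j - i))%N; last lia.
by rewrite modnDl modn_small; lia.
Qed.

End CyclicSum.

(** * Points of the circle up to sign *)

Section Circle.
Variable R : realType.
Implicit Types (x y : 'cV[R]_2) (a b : R).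

Lemma dot_sign_expi (e1 e2 : bool) a b :
  `|dot ((-1) ^+ e1 *: expi a) ((-1) ^+ e2 *: expi b)| = `|cos (b - a)|.
Proof.
rewrite /dot !big_ord_recl big_ord0 !mxE /= cosB addr0.
set s1 := (-1) ^+ e1; set s2 := (-1) ^+ e2.
have -> : s1 * cos a * (s2 * cos b) + s1 * sin a * (s2 * sin b) =
    s1 * (s2 * (cos b * cos a + sin b * sin a)) by ring.
by rewrite !normrM !normr_sign !mul1r.
Qed.

Lemma proj_kernel_expi f (e1 e2 : bool) a b :
  proj_kernel f ((-1) ^+ e1 *: expi a) ((-1) ^+ e2 *: expi b) =
  extend0 f (Num.sqrt 2 * `|sin (b - a)|).
Proof.
rewrite /proj_kernel dot_sign_expi -normrX ger0_norm ?sqr_ge0//.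
by rewrite cos2sin2 mulrBr mulr1 subKr sqrtrM// sqrtr_sqr.
Qed.

Lemma unit_circle_expi a : unit_circle (expi a).
Proof.
rewrite /unit_circle /= /dot !big_ord_recl big_ord0 !mxE /= addr0.
by rewrite -!expr2 cos2Dsin2.
Qed.

(** Changing the sign of a point of the lower half-plane moves it to the upper
    one, where the angle is the [acos] of the first coordinate. *)
Lemma unit_circle_half_angle x : unit_circle x ->
  exists a, exists e : bool, 0 <= a <= pi /\ x = (-1) ^+ e *: expi a.
Proof.
rewrite /unit_circle /= /dot !big_ord_recl big_ord0 addr0 -!expr2.
set u := x _ _; set v := x _ _ => uv.
have upper (w z : R) : w ^+ 2 + z ^+ 2 = 1 -> 0 <= z ->
    [/\ 0 <= acos w <= pi, cos (acos w) = w & sin (acos w) = z].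
  move=> wz z0.
  have w1 : -1 <= w <= 1 by nra.
  split; first by rewrite acos_ge0 ?acos_lepi.
    by rewrite acosK // in_itv.
  rewrite sin_acos // (_ : 1 - w ^+ 2 = z ^+ 2) ?sqrtr_sqr ?ger0_norm//.
  by rewrite -wz; ring.
pose e := v < 0; pose s : R := (-1) ^+ e.
have ss : s * s = 1 by rewrite -expr2 sqrr_sign.
have [|| a0 ca sa] := upper (s * u) (s * v).
- by rewrite !exprMn expr2 ss !mul1r.
- by rewrite /s /e; case: ltP => h; rewrite ?expr1 ?expr0; lra.
exists (acos (s * u)), e; split => //.
apply/colP => i; rewrite !mxE -/s ca sa; case: eqP => [->|/eqP i0].
  by rewrite mulrA ss mul1r.
have -> : i = lift ord0 ord0 by apply/val_inj; case: i i0 => -[|[|]].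
by rewrite mulrA ss mul1r.
Qed.

Lemma sort_family (N : nat) (theta : 'I_N -> R) :
  exists s : 'S_N, forall i j : 'I_N, (i <= j)%N -> theta (s i) <= theta (s j).
Proof.
pose t := [tuple theta i | i < N].
have /tuple_permP[s st] : perm_eq (sort <=%O t) t by rewrite perm_sort.
exists s => i j ij.
have nthE (k : 'I_N) : theta (s k) = nth 0 (sort <=%O t) k.
  by rewrite st -tnth_nth !tnth_mktuple.
rewrite !nthE; apply: (sorted_leq_nth le_trans lexx) => //.
- exact: sort_sorted le_total _.
- by rewrite inE size_sort size_tuple.
- by rewrite inE size_sort size_tuple.
Qed.

Lemma sorted_half_angles (N : nat) (X : 'I_N -> 'cV[R]_2) : in_circle X ->
  exists (theta : 'I_N -> R) (e : 'I_N -> bool) (s : 'S_N),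
    [/\ forall i, 0 <= theta i <= pi,
        forall i j : 'I_N, (i <= j)%N -> theta i <= theta j &
        forall i, X (s i) = (-1) ^+ e i *: expi (theta i)].
Proof.
move=> Xc.
have /choice[a /choice[e ae]] i := unit_circle_half_angle (Xc i).
have [s sa] := sort_family a.
by exists (a \o s), (e \o s), s; split=> // i; case: (ae (s i)).
Qed.

Lemma energy_permE K (N : nat) (X : 'I_N -> 'cV[R]_2) (s : 'S_N) :
  energy K X = (\sum_(p : 'I_N * 'I_N | p.1 != p.2) K (X (s p.1)) (X (s p.2)))%E.
Proof.
rewrite /energy pair_big_dep /=.
rewrite (reindex_inj (h := fun p : 'I_N * 'I_N => (s p.1, s p.2)))/=.
  by apply: eq_bigl => p; rewrite (inj_eq perm_inj).
by move=> [i j] [i' j'] [/perm_inj-> /perm_inj->].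
Qed.

Definition grid (N : nat) (i : 'I_N) : R := i%:R * pi / N%:R.

(** The counterclockwise angle from the i-th to the j-th line through 0, in
    [[0, pi]] when the angles [theta] are sorted. *)
Definition turn (N : nat) (theta : 'I_N -> R) (i j : 'I_N) : R :=
  theta j - theta i + (if (j < i)%N then pi else 0).

Lemma turn_ge0_lepi (N : nat) (theta : 'I_N -> R) i j :
  (forall i, 0 <= theta i <= pi) ->
  (forall i j : 'I_N, (i <= j)%N -> theta i <= theta j) ->
  0 <= turn theta i j <= pi.
Proof.
move=> tp tm; rewrite /turn; have := tp i; have := tp j.
by case: ltnP => [/ltnW|] /tm; lra.
Qed.

Lemma proj_kernel_turn f (N : nat) (theta : 'I_N -> R) (e1 e2 : bool) i j :
  0 <= turn theta i j <= pi ->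
  proj_kernel f ((-1) ^+ e1 *: expi (theta i)) ((-1) ^+ e2 *: expi (theta j)) =
  extend0 f (Num.sqrt 2 * sin (turn theta i j)).
Proof.
move=> tp; rewrite proj_kernel_expi; congr (extend0 f (_ * _)).
rewrite -[RHS]ger0_norm ?sin_ge0_pi// /turn.
by case: ifP => _; rewrite ?addr0// sinDpi normrN.
Qed.

Lemma turn_grid n (i j : 'I_n.+1) :
  turn (@grid n.+1) i j = grid (j - i : 'I_n.+1).
Proof.
have := ord_subE i j => /(congr1 (fun k : nat => k%:R : R)).
rewrite !natrD natrM /turn /grid => h.
have -> : (j - i)%R%:R = j%:R + (j < i)%N%:R * n.+1%:R - i%:R :> R.
  by rewrite -h addrK.
have : n.+1%:R != 0 :> R by rewrite pnatr_eq0.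
by move: n.+1%:R => z z0; case: ltnP => _; rewrite ?mul1r ?mul0r; field.
Qed.

Lemma grid_gt0_ltpi n (k : 'I_n.+1) : k != 0 -> 0 < grid k < pi.
Proof.
move=> k0; rewrite /grid divr_gt0 ?mulr_gt0 ?pi_gt0 ?ltr0n ?lt0n//=.
by rewrite ltr_pdivrMr ?ltr0n// mulrC ltr_pM2l ?pi_gt0// ltr_nat.
Qed.

Lemma grid_ge0_lepi (N : nat) (i : 'I_N) : 0 <= grid i <= pi.
Proof.
case: N i => [[]//|n] i; rewrite /grid divr_ge0 ?mulr_ge0 ?pi_ge0//=.
by rewrite ler_pdivrMr ?ltr0n// mulrC ler_pM2l ?pi_gt0// ler_nat ltnW.
Qed.

Lemma grid_le (N : nat) (i j : 'I_N) : (i <= j)%N -> grid i <= grid j.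
Proof.
move=> ij; rewrite /grid ler_wpM2r ?invr_ge0// ler_wpM2r ?pi_ge0//.
by rewrite ler_nat.
Qed.

Definition rotation a : 'M[R]_2 :=
  \matrix_(i, j) (if i == j then cos a else if i == 0 then - sin a else sin a).

Lemma orthogonal_rotation a : orthogonal_mx (rotation a).
Proof.
apply/matrixP => i j; rewrite !mxE !big_ord_recl big_ord0 !mxE.
have := cos2Dsin2 a.
by case: i j => -[|[|]]// ? [[|[|]]// ?] /= h; rewrite /= -?h; ring.
Qed.

Lemma rotation_expi a b : rotation a *m expi b = expi (a + b).
Proof.
apply/colP => i; rewrite !mxE !big_ord_recl big_ord0 !mxE cosD sinD.
by case: i => -[|[|]]// ? /=; ring.
Qed.

End Circle.

(** * The energy of a sorted configuration *)

Section Energy.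
Variables (R : realType) (f : R -> R).
Hypothesis f_convex : @convex_function R R^o `]0, Num.sqrt 2]%classic f.
Hypothesis f_nonincreasing : {in `]0, Num.sqrt 2] &, nonincreasing_fun f}.
Variables (n : nat) (theta : 'I_n.+1 -> R) (e : 'I_n.+1 -> bool).
Variables (X : 'I_n.+1 -> 'cV[R]_2) (s : 'S_n.+1).
Hypothesis theta_pi : forall i, 0 <= theta i <= pi.
Hypothesis theta_le : forall i j : 'I_n.+1, (i <= j)%N -> theta i <= theta j.
Hypothesis X_theta : forall i, X (s i) = (-1) ^+ e i *: expi (theta i).

Let value (k : 'I_n.+1) := f (Num.sqrt 2 * sin (grid R k)).

Lemma energy_half_circle :
  energy (proj_kernel f) (half_circle_config R n.+1) =
  (\sum_(p : 'I_n.+1 * 'I_n.+1 | p.1 != p.2) value (p.2 - p.1))%:E.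
Proof.
rewrite (energy_permE _ _ 1) -sumEFin; apply: eq_bigr => -[i j] /= ij.
rewrite !perm1 -[half_circle_config _ _ i]scale1r.
rewrite -[half_circle_config _ _ j]scale1r.
rewrite (proj_kernel_turn (theta := @grid R n.+1) f false false); last first.
  by apply: turn_ge0_lepi => *; [exact: grid_ge0_lepi | exact: grid_le].
have ji : j - i != 0 by rewrite subr_eq0 eq_sym.
rewrite turn_grid /extend0 gt_eqF// mulr_gt0 ?sqrtr_gt0// sin_gt0_pi//.
exact: grid_gt0_ltpi.
Qed.

(** The supporting lines of [angular_support] at the points [grid k], one for
    each cyclic difference [k]; their values at the turns of [theta] have the
    same total as the half-circle energy by [cyclic_sum_diff0]. *)
Lemma energy_linear_bound : exists a : 'I_n.+1 * 'I_n.+1 -> R,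
  \sum_(p | p.1 != p.2) a p = \sum_(p | p.1 != p.2) value (p.2 - p.1) /\
  forall p, p.1 != p.2 ->
    ((a p)%:E <= proj_kernel f (X (s p.1)) (X (s p.2)))%E /\
    ((forall u v, 0 < u -> u < v -> v <= Num.sqrt 2 -> f v < f u) ->
     turn theta p.1 p.2 != grid R (p.2 - p.1) ->
     ((a p)%:E < proj_kernel f (X (s p.1)) (X (s p.2)))%E).
Proof.
have /choice[m mP] (k : 'I_n.+1) :
  exists m, k != 0 -> forall x, 0 <= x <= pi ->
    ((value k + m * (x - grid R k))%:E <= extend0 f (Num.sqrt 2 * sin x))%E /\
    ((forall u v, 0 < u -> u < v -> v <= Num.sqrt 2 -> f v < f u) ->
     x != grid R k ->
     ((value k + m * (x - grid R k))%:E < extend0 f (Num.sqrt 2 * sin x))%E).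
  have [->|k0] := eqVneq k 0; first by exists 0.
  have [m mP] := angular_support f_convex f_nonincreasing (grid_gt0_ltpi R k0).
  by exists m.
exists (fun p => value (p.2 - p.1) +
  m (p.2 - p.1) * (turn theta p.1 p.2 - grid R (p.2 - p.1))); split.
  rewrite big_split /= -[RHS]addr0; congr +%R.
  rewrite -[RHS](cyclic_sum_diff0 m (fun i => theta i - grid R i)).
  apply: eq_bigr => -[i j] /= _; rewrite -turn_grid /turn; ring.
move=> [i j] /= ij; rewrite !X_theta proj_kernel_turn ?turn_ge0_lepi//.
by apply: mP; rewrite ?turn_ge0_lepi// subr_eq0 eq_sym.
Qed.

Lemma energy_half_circle_le :
  (energy (proj_kernel f) (half_circle_config R n.+1) <=
   energy (proj_kernel f) X)%E.
Proof.
have [a [aE aP]] := energy_linear_bound.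
rewrite energy_half_circle -aE (energy_permE _ _ s) -sumEFin.
by apply: lee_sum => p /aP[].
Qed.

(** Equality of the energies forces [turn theta i j = grid (j - i)] for every
    pair; the pairs [(0, i)] are enough to conclude. *)
Lemma energy_le_half_circle_shift :
  (forall u v, 0 < u -> u < v -> v <= Num.sqrt 2 -> f v < f u) ->
  (energy (proj_kernel f) X <=
   energy (proj_kernel f) (half_circle_config R n.+1))%E ->
  forall i, theta i - grid R i = theta ord0 - grid R (ord0 : 'I_n.+1).
Proof.
have [a [aE aP]] := energy_linear_bound => fdec.
rewrite energy_half_circle -aE (energy_permE _ _ s) => le_a i.
have [->//|i0] := eqVneq i ord0.
have p0 : (ord0 : 'I_n.+1, i).1 != (ord0 : 'I_n.+1, i).2 by rewrite /= eq_sym.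
have := sum_lee_not_lt (fun p pp => (aP p pp).1) le_a p0.
apply: contraNeq => ne; apply: (aP _ p0).2 => //; apply: contra ne => /= /eqP.
rewrite -turn_grid /turn !ltn0 !addr0 => h; apply/eqP; move: h; lra.
Qed.

End Energy.


(** * Minimality and uniqueness *)

Lemma half_circle_minimizes (R : realType) (f : R -> R) (N : nat) :
  @convex_function R R^o `]0, Num.sqrt 2]%classic f ->
  {in `]0, Num.sqrt 2] &, nonincreasing_fun f} ->
  energy_minimizer (proj_kernel f) (half_circle_config R N).
Proof.
move=> f_convex f_nonincreasing; split=> [i|Y Yc]; first exact: unit_circle_expi.
case: N Y Yc => [|n] Y Yc; first by rewrite /energy !big_ord0.
have [theta [e [s [tp tl Ye]]]] := sorted_half_angles Yc.
exact: (energy_half_circle_le f_convex f_nonincreasing tp tl Ye).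
Qed.

(** A minimizer has the sorted angles of the half circle translated by a
    constant; the rotation by the opposite angle is the required operator. *)
Lemma half_circle_unique (R : realType) (f : R -> R) (N : nat)
    (X : 'I_N -> 'cV[R]_2) :
  @convex_function R R^o `]0, Num.sqrt 2]%classic f ->
  {in `]0, Num.sqrt 2] &, nonincreasing_fun f} ->
  (forall u v, 0 < u -> u < v -> v <= Num.sqrt 2 -> f v < f u) ->
  energy_minimizer (proj_kernel f) X ->
  projectively_equivalent X (half_circle_config R N).
Proof.
move=> f_convex f_nonincreasing f_decreasing [Xc Xmin].
case: N X Xc Xmin => [|n] X Xc Xmin.
  by exists (rotation 0), xpredT, 1%g; split=> [|[]//]; exact: orthogonal_rotation.
have [theta [e [s [tp tl Xe]]]] := sorted_half_angles Xc.
have /Xmin le_half : in_circle (half_circle_config R n.+1).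
  by move=> i; exact: unit_circle_expi.
have shift := energy_le_half_circle_shift f_convex f_nonincreasing tp tl Xe
  f_decreasing le_half.
exists (rotation (grid R (ord0 : 'I_n.+1) - theta ord0)), e, s.
split=> [|i]; first exact: orthogonal_rotation.
rewrite Xe -scalemxAr scalerA -expr2 sqrr_sign scale1r rotation_expi.
by congr expi; rewrite -/(grid R i); have := shift i; lra.
Qed.

Theorem theorem5p1 (R : realType) (f : R -> R)
  (f_nonincreasing : {in `]0, Num.sqrt 2] &, nonincreasing_fun f})
  (f_convex : @convex_function R R^o `]0, Num.sqrt 2]%classic f) :
  (forall N : nat,
     energy_minimizer (proj_kernel f) (half_circle_config R N)) /\
  (@strictly_convex_function R R^o `]0, Num.sqrt 2]%classic f ->
   forall (N : nat) (X : 'I_N -> 'cV[R]_2),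
     energy_minimizer (proj_kernel f) X ->
     projectively_equivalent X (half_circle_config R N)).
Proof.
split=> [N|f_strict N X]; first exact: half_circle_minimizes.
apply: half_circle_unique => //.
exact: strictly_convex_nonincreasing_decreasing.
Qed.
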